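(* Suppose a real Banach space $\mathcal{X}$ is not $1$-injective. Then $\tilde{\mathcal{X}}=\mathbb{R}\oplus_1\mathcal{X}$ contains a bounded centrally symmetric subset $K$ such that $d_1^a(K)<d_1(K,\tilde{\mathcal{X}})$.
   Context: A Banach space $\mathcal{Y}$ is $1$-injective if for every Banach space $G$, every subspace $F\subset G$ and every bounded linear $T:F\to\mathcal{Y}$ there is a linear extension $\tilde T:G\to\mathcal{Y}$ of $T$ with $\|\tilde T\|\le\|T\|$. $\mathbb{R}\oplus_1\mathcal{X}$ carries the norm $\|t\oplus x\|=|t|+\|x\|$. Centrally symmetric means $K=-K$. For a bounded subset $K$ of a Banach space $\mathcal{X}$ and an integer $n\ge 0$, the Kolmogorov width is $d_n(K,\mathcal{X})=\inf_{\mathcal{X}_n}\sup_{x\in K}\inf_{z\in\mathcal{X}_n}\|x-z\|$, the outer infimum being over all linear subspaces $\mathcal{X}_n\subset\mathcal{X}$ of dimension at most $n$. For a bounded $K$ in a Banach space $\mathcal{Y}$, the absolute width is $d_n^a(K)=\inf_{\mathcal{Z}}d_n(K,\mathcal{Z})$, the infimum being over all Banach spaces $\mathcal{Z}$ containing $\mathcal{Y}$ isometrically as a subspace. *)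

(* Defs.v *)
From HB Require Import structures.
From mathcomp Require Import all_boot all_order all_algebra.
From mathcomp Require Import all_classical all_reals all_analysis.

Set Implicit Arguments.
Unset Strict Implicit.
Unset Printing Implicit Defensive.

Import Order.TTheory GRing.Theory Num.Theory.
Import numFieldNormedType.Exports.

Local Open Scope classical_set_scope.
Local Open Scope ring_scope.

(* A linear subspace F of a normed module G, as a type, with the norm of G.
   F is not assumed to be closed. *)
Section SubspaceType.
Variables (R : realType) (G : normedModType R) (F : submodClosed G).

Record subspace_of : predArgType :=
  SubspaceOf { subspace_val : G ; _ : subspace_val \in F }.

HB.instance Definition _ := [isSub for subspace_val].
HB.instance Definition _ := [Choice of subspace_of by <:].
HB.instance Definition _ := [SubChoice_isSubLmodule of subspace_of by <:].

Definition subspace_norm (x : subspace_of) : R := `|val x|.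

Let subspace_normD x y :
  subspace_norm (x + y) <= subspace_norm x + subspace_norm y.
Proof. by rewrite /subspace_norm raddfD ler_normD. Qed.

Let subspace_normZ (a : R) x :
  subspace_norm (a *: x) = `|a| * subspace_norm x.
Proof. by rewrite /subspace_norm linearZ normrZ. Qed.

Let subspace_norm0_eq0 x : subspace_norm x = 0 -> x = 0.
Proof. by move=> /normr0_eq0 x0; apply: val_inj; rewrite x0 raddf0. Qed.

HB.instance Definition _ := Lmodule_isNormed.Build R subspace_of
  subspace_normD subspace_normZ subspace_norm0_eq0.

End SubspaceType.

(* The direct sum of two Banach spaces with the norm `|v| + `|w|; the canonical
   norm of the library on V * W is the maximum norm, hence a new type. *)
Section L1Sum.
Variables (R : realType) (V W : completeNormedModType R).

Definition l1_sum : Type := (V * W)%type.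

HB.instance Definition _ := GRing.Lmodule.copy l1_sum (V * W)%type.

Definition l1_norm (u : l1_sum) : R := `|u.1| + `|u.2|.

Let l1_normD u v : l1_norm (u + v) <= l1_norm u + l1_norm v.
Proof. by rewrite /l1_norm addrACA lerD// ler_normD. Qed.

Let l1_normZ (a : R) u : l1_norm (a *: u) = `|a| * l1_norm u.
Proof. by rewrite /l1_norm mulrDr -!normrZ. Qed.

Let l1_norm0_eq0 u : l1_norm u = 0 -> u = 0.
Proof.
case: u => v w /eqP; rewrite /l1_norm paddr_eq0//= !normr_eq0.
by move=> /andP[/eqP -> /eqP ->].
Qed.

HB.instance Definition _ := Lmodule_isNormed.Build R l1_sum
  l1_normD l1_normZ l1_norm0_eq0.

Lemma l1_normE (u : l1_sum) : `|u| = `|u.1| + `|u.2|.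
Proof. by []. Qed.

Let l1_complete (A : set_system l1_sum) :
  ProperFilter A -> cauchy A -> cvg A.
Proof.
move=> PA /cauchy_ballP cA.
have cA1 : cauchy ((fun u : l1_sum => u.1 : V) @ A).
  apply/cauchy_ballP => e e0; have := cA e e0.
  move=> [[P Q] /= [AP AQ] PQ].
  exists (fst @` P, fst @` Q) => /=.
    by split; [apply: filterS AP|apply: filterS AQ] => x; exists x.
  move=> [_ _] /= [[x Px <-] [y Qy <-]].
  have := PQ (x, y) (conj Px Qy).
  rewrite -!ball_normE /ball_ /= l1_normE; apply: le_lt_trans.
  by rewrite lerDl.
have cA2 : cauchy ((fun u : l1_sum => u.2 : W) @ A).
  apply/cauchy_ballP => e e0; have := cA e e0.
  move=> [[P Q] /= [AP AQ] PQ].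
  exists (snd @` P, snd @` Q) => /=.
    by split; [apply: filterS AP|apply: filterS AQ] => x; exists x.
  move=> [_ _] /= [[x Px <-] [y Qy <-]].
  have := PQ (x, y) (conj Px Qy).
  rewrite -!ball_normE /ball_ /= l1_normE; apply: le_lt_trans.
  by rewrite lerDr.
have /cvg_ex[v /= cv] : cvg ((fun u : l1_sum => u.1 : V) @ A).
  exact: cauchy_cvg cA1.
have /cvg_ex[w /= cw] : cvg ((fun u : l1_sum => u.2 : W) @ A).
  exact: cauchy_cvg cA2.
apply/cvg_ex; exists ((v, w) : l1_sum).
apply/cvgrPdist_lt => e e0; have e20 : 0 < e / 2 by rewrite divr_gt0.
move/cvgrPdist_lt: cv => /(_ _ e20) cv.
move/cvgrPdist_lt: cw => /(_ _ e20) cw.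
near=> u; rewrite l1_normE /= (splitr e) ltrD//.
  by near: u; exact: cv.
by near: u; exact: cw.
Unshelve. all: by end_near. Qed.

HB.instance Definition _ := Uniform_isComplete.Build l1_sum l1_complete.

End L1Sum.

Definition op_norm (R : realType) (V W : normedModType R)
    (f : {linear V -> W}) : \bar R :=
  ereal_sup [set `|f x|%:E | x in [set x : V | `|x| <= 1]].

Definition one_injective (R : realType) (Y : completeNormedModType R) : Prop :=
  forall (G : completeNormedModType R) (F : submodClosed G)
         (T : {linear subspace_of F -> Y}),
    bounded_fun_norm T ->
    exists S : {linear G -> Y},
      (forall x : subspace_of F, S (val x) = T x) /\
      (op_norm S <= op_norm T)%E.

Definition linearly_independent (R : realType) (X : lmodType R) (m : nat)
    (e : 'I_m -> X) : Prop :=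
  forall c : 'I_m -> R, \sum_(i < m) c i *: e i = 0 -> forall i, c i = 0.

Definition has_dim (R : realType) (X : lmodType R) (V : submodClosed X)
    (m : nat) : Prop :=
  exists e : 'I_m -> X, linearly_independent e /\
    forall x, x \in V <-> exists c : 'I_m -> R, x = \sum_(i < m) c i *: e i.

Definition dim_at_most (R : realType) (X : lmodType R) (n : nat)
    (V : submodClosed X) : Prop :=
  exists2 m : nat, (m <= n)%N & has_dim V m.

Definition kolmogorov_width (R : realType) (X : normedModType R) (n : nat)
    (K : set X) : \bar R :=
  ereal_inf [set ereal_sup [set ereal_inf [set `|x - z|%:E | z in [set` V]]
                               | x in K]
                | V in [set V : submodClosed X | dim_at_most n V]].

Definition absolute_width (R : realType) (Y : completeNormedModType R)
    (n : nat) (K : set Y) : \bar R :=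
  ereal_inf [set d | exists (Z : completeNormedModType R) (i : {linear Y -> Z}),
                       (forall y, `|i y| = `|y|) /\
                       d = kolmogorov_width n (i @` K)].

(* Main.v *)
(* Fix q <> 0 in a Banach space V. If balls B(c, r) of V intersect pairwise, they
   have a common point in a larger, hyperconvex space. If on the other hand no
   point of V lies, modulo q, in all of them (with some slack), then the
   set of the points (c + N q) / r, N large, and their opposites has first width
   larger than 1 in V, but absolute width at most 1. For V = R (+)_1 X there are
   two sources of such balls.
   - If X has dimension at least 3, choose unit vectors a, b with |a + b|,
     |a - b| < 2, norming functionals for a and b, and q <> 0 in both kernels.
     The unit balls centred at (h, a), (h, -a), (-h, b), (-h, -b), for
     h = 1 - max(|a + b|, |a - b|) / 2, intersect pairwise, but a common point
     modulo (0, q) would have its first coordinate equal to h and to -h.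
   - If X has dimension at most 2 and is not 1-injective, then it is not
     hyperconvex, since hyperconvexity allows one-dimensional extensions and so,
     by Zorn, all extensions. By compactness some pairwise intersecting balls of
     bounded radii have no common point even after a small enlargement; take
     q = (1, 0), as R (+)_1 X modulo q is X. *)

Require Import Defs.
From HB Require Import structures.
From mathcomp Require Import all_boot all_order all_algebra.
From mathcomp Require Import all_classical all_reals all_analysis.
From mathcomp Require Import lra.

Set Implicit Arguments.
Unset Strict Implicit.
Unset Printing Implicit Defensive.

Import Order.TTheory GRing.Theory Num.Theory.
Import numFieldNormedType.Exports.

Local Open Scope classical_set_scope.
Local Open Scope ring_scope.

(** * Hyperconvexity and norm-preserving extension of operators *)

(** A pair in [B] is a ball, given by centre and radius. In a normed space the inequality says that
    two closed balls meet; for [b = b'] it makes the radii nonnegative. *)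
Definition hyperconvex (R : realType) (Y : normedModType R) : Prop :=
  forall B : set (Y * R),
    (forall b b', B b -> B b' -> `|b.1 - b'.1| <= b.2 + b'.2) ->
    exists y, forall b, B b -> `|b.1 - y| <= b.2.

(** The graph of a linear map of norm at most [M] on some subspace. It is single-valued because a
    point [(0, y)] satisfies [|y| <= 0]. *)
Definition dominated_graph (R : realType) (G Y : normedModType R) (M : R)
    (E : set (G * Y)) : Prop :=
  [/\ E 0, forall k p q, E p -> E q -> E (k *: p + q) &
      forall p, E p -> `|p.2| <= M * `|p.1| ].

(** A value [y0] at [x0] must lie in the balls of centre [e.2] and radius [M * |e.1 - x0|]. By
    domination of differences these meet pairwise, so hyperconvexity provides it. *)
Lemma dominated_graph_extend (R : realType) (G Y : normedModType R) (M : R)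
    (E : set (G * Y)) (x0 : G) :
  hyperconvex Y -> 0 <= M -> dominated_graph M E ->
  exists y0, dominated_graph M
    [set p | exists k e, E e /\ p = k *: (x0, y0) + e].
Proof.
move=> hY M0 [E0 Elin Edom].
have [b b'|y0 hy0] := hY [set b | exists2 e, E e & b = (e.2, M * `|e.1 - x0|)].
  move=> [e Ee ->] [f Ef ->] /=.
  have : E ((-1) *: f + e) by exact: Elin.
  move=> /Edom /=; rewrite !scaleN1r ![- _ + _]addrC => /le_trans; apply.
  by rewrite -mulrDr ler_wpM2l// (le_trans (ler_distD x0 _ _))// (distrC x0).
exists y0; split.
- by exists 0, 0; rewrite scale0r addr0.
- move=> k p q [k1 [e1 [Ee1 ->]]] [k2 [e2 [Ee2 ->]]].
  exists (k * k1 + k2), (k *: e1 + e2); split; first exact: Elin.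
  by rewrite scalerDr scalerA scalerDl addrACA.
- move=> _ [k [e [Ee ->]]] /=.
  have [->|k0] := eqVneq k 0; first by rewrite !scale0r !add0r Edom.
  (* Dividing by [- k] reduces the bound to the ball given by the point [- k^-1 *: e] of [E]. *)
  have Ee' : E (- k^-1 *: e) by rewrite -[_ *: _]addr0; exact: Elin.
  have := hy0 _ (ex_intro2 _ _ _ Ee' erefl); rewrite /= => h.
  have -> : k *: y0 + e.2 = - k *: (- k^-1 *: e.2 - y0).
    rewrite scalerBr scalerA mulNr mulrN opprK mulfV// scale1r.
    by rewrite scaleNr opprK addrC.
  have -> : k *: x0 + e.1 = - k *: (- k^-1 *: e.1 - x0).
    rewrite scalerBr scalerA mulNr mulrN opprK mulfV// scale1r.
    by rewrite scaleNr opprK addrC.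
  by rewrite !normrZ mulrCA ler_wpM2l.
Qed.

Lemma dominated_graph_total (R : realType) (G Y : normedModType R) (M : R)
    (A : set (G * Y)) :
  hyperconvex Y -> 0 <= M -> dominated_graph M A ->
  exists E, [/\ A `<=` E, dominated_graph M E & forall x, exists y, E (x, y)].
Proof.
move=> hY M0 gA.
(* Joining [A] to [D] makes the property hold for the empty chain too, whose union is empty. *)
pose P := [set D | dominated_graph M (A `|` D)].
have [F FP totF|D [PD Dmax]] := @Zorn_bigcup _ P.
  have PF p q : (A `|` \bigcup_(X in F) X) p -> (A `|` \bigcup_(X in F) X) q ->
      exists X, [/\ dominated_graph M (A `|` X), (A `|` X) p, (A `|` X) q &
                    X `<=` \bigcup_(X in F) X].
    move=> [Ap|[X FX Xp]] [Aq|[X' FX' X'q]].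
    - exists set0; split; [by rewrite setU0|by left|by left|by []].
    - exists X'; split; [exact: FP|by left|by right|exact: bigcup_sup].
    - exists X; split; [exact: FP|by right|by left|exact: bigcup_sup].
    - have [XX'|X'X] := totF _ _ FX FX'.
        exists X'; split; [exact: FP|by right; apply: XX'|by right|].
        exact: bigcup_sup.
      exists X; split; [exact: FP|by right|by right; apply: X'X|].
      exact: bigcup_sup.
  split; first by left; case: gA.
    move=> k p q Pp Pq; have [X [[_ Xlin _] Xp Xq XF]] := PF _ _ Pp Pq.
    by have := Xlin k _ _ Xp Xq; move=> [?|/XF ?]; [left|right].
  by move=> p Pp; have [X [[_ _ Xdom] Xp _ _]] := PF _ _ Pp Pp; exact: Xdom.
exists (A `|` D); split => // x0.
have [y0 gy0] := dominated_graph_extend x0 hY M0 PD.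
set D' := [set p | _] in gy0.
have AD' : A `|` D `<=` D'.
  by move=> p Ap; exists 0, p; rewrite scale0r add0r.
exists y0; right; apply: contrapT => nD.
apply: (Dmax D').
  split; first by move=> p Dp; apply: AD'; right.
  apply: contra_not nD; apply; exists 1, 0; rewrite scale1r addr0; split => //.
  by case: PD.
rewrite /P /= (_ : A `|` D' = D')//.
by apply: setUidr => p Ap; apply: AD'; left.
Qed.

Lemma dominated_extension (R : realType) (G Y : normedModType R) (M : R)
    (A : set (G * Y)) :
  hyperconvex Y -> 0 <= M -> dominated_graph M A ->
  exists S : {linear G -> Y},
    (forall p, A p -> S p.1 = p.2) /\ forall x, `|S x| <= M * `|x|.
Proof.
move=> hY M0 gA.
have [E [AE [_ Elin Edom] /choice[f Ef]]] := dominated_graph_total hY M0 gA.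
have Euniq x y y' : E (x, y) -> E (x, y') -> y = y'.
  move=> Ey Ey'; have /Edom /= := Elin (-1) _ _ Ey Ey'.
  rewrite !scaleN1r addNr normr0 mulr0 normr_le0 addrC subr_eq0.
  by move=> /eqP.
have lf : linear f.
  by move=> k x y; apply: (Euniq _ _ _ (Ef _)); apply: (Elin _ (x, _) (y, _)).
pose S : {linear G -> Y} := HB.pack f (GRing.isLinear.Build _ _ _ _ f lf).
exists S; split => /=.
  by move=> [x y] /AE Exy; exact: Euniq Exy.
by move=> x; exact: (Edom (x, f x)).
Qed.

Lemma op_norm_bound (R : realType) (V W : normedModType R)
    (T : {linear V -> W}) :
  bounded_fun_norm T -> exists2 M, 0 <= M &
    op_norm T = M%:E /\ forall x, `|T x| <= M * `|x|.
Proof.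
move=> /(_ 1)[C TC].
have T0 : (0 <= op_norm T)%E.
  by apply: ereal_sup_ubound; exists 0; rewrite /= ?linear0 normr0.
have Toub x : `|x| <= 1 -> (`|T x|%:E <= op_norm T)%E.
  by move=> x1; apply: ereal_sup_ubound; exists x.
have TC' : (op_norm T <= C%:E)%E.
  by apply: ge_ereal_sup => _ [x /= x1 <-]; rewrite lee_fin TC.
have Tfin : op_norm T \is a fin_num.
  by rewrite fin_numE; apply/andP; split; apply/eqP => h;
    move: T0 TC'; rewrite h.
exists (fine (op_norm T)); first exact: fine_ge0.
split; first by rewrite fineK.
move=> x; have [->|x0] := eqVneq x 0; first by rewrite linear0 !normr0 mulr0.
have nx : 0 < `|x| by rewrite normr_gt0.
rewrite -ler_pdivrMr// -lee_fin fineK//.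
have -> : `|T x| / `|x| = `|T (`|x|^-1 *: x)|.
  by rewrite linearZ normrZ normfV normr_id mulrC.
by apply: Toub; rewrite normrZ normfV normr_id mulVf// gt_eqF.
Qed.

Lemma hyperconvex_one_injective (R : realType) (Y : completeNormedModType R) :
  hyperconvex Y -> one_injective Y.
Proof.
move=> hY G F T /op_norm_bound[M M0 [-> TM]].
have [|S [SA SM]] := @dominated_extension _ G Y M
  [set p | exists x : subspace_of F, p = (val x, T x)] hY M0.
- split; first by exists 0; rewrite !linear0.
    by move=> k _ _ [x ->] [y ->]; exists (k *: x + y); rewrite !linearP.
  by move=> _ [x ->] /=; exact: TM.
- exists S; split; first by move=> x; apply: (SA (val x, T x)); exists x.
  apply: ge_ereal_sup => _ [x /= x1 <-]; rewrite lee_fin.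
  by rewrite (le_trans (SM x))// ler_piMr.
Qed.

(** Each left endpoint is at most each right endpoint, so the supremum of the left endpoints lies in
    every interval. *)
Lemma hyperconvex_real (R : realType) : hyperconvex R^o.
Proof.
move=> B hB; have [->|/set0P[b0 Bb0]] := eqVneq B set0; first by exists 0.
have ub b : B b -> ubound [set b.1 - b.2 | b in B] (b.1 + b.2).
  move=> Bb _ [b' Bb' <-]; have := hB _ _ Bb' Bb; rewrite ler_norml; lra.
exists (sup [set b.1 - b.2 | b in B]) => b Bb.
have h1 : sup [set b.1 - b.2 | b in B] <= b.1 + b.2.
  by apply: ge_sup; [exists (b0.1 - b0.2), b0|exact: ub].
have h2 : b.1 - b.2 <= sup [set b.1 - b.2 | b in B].
  by apply: ub_le_sup; [exists (b0.1 + b0.2); exact: ub|exists b].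
rewrite ler_norml; lra.
Qed.

(** A Hahn-Banach argument: the map sending [t *: x] to [t * |x|] is extended from the line of
    [x]. *)
Lemma norming_functional (R : realType) (G : normedModType R) (x : G) :
  exists phi : {linear G -> R^o}, phi x = `|x| /\ forall y, `|phi y| <= `|y|.
Proof.
have [|phi [phix phiM]] := @dominated_extension _ G R^o 1
  [set p | exists t : R, p = (t *: x, t * `|x|)] (@hyperconvex_real R) ler01.
  split; first by exists 0; rewrite scale0r mul0r.
    move=> k _ _ [t ->] [u ->]; exists (k * t + u).
    by rewrite mulrDl scalerDl -mulrA -scalerA.
  by move=> _ [t ->] /=; rewrite mul1r normrM normrZ normr_id.
exists phi; split; last by move=> y; rewrite -[leRHS]mul1r.
by apply: (phix (x, `|x|)); exists 1; rewrite scale1r mul1r.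
Qed.

(** * The hyperconvex space of bounded functions, and isometric embedding into it *)

Section BoundedFunctions.
Variables (R : realType) (T : Type).

Definition bounded_pred : {pred T -> R} :=
  fun f => `[< exists M, forall t, `|f t| <= M >].

Let bounded_pred_submod : submod_closed bounded_pred.
Proof.
split; first by apply/asboolP; exists 0 => t; rewrite normr0.
move=> k f g /asboolP[M fM] /asboolP[N gN]; apply/asboolP.
exists (`|k| * M + N) => t; rewrite (le_trans (ler_normD _ _))// lerD//.
by rewrite normrZ ler_wpM2l.
Qed.

HB.instance Definition _ :=
  GRing.isSubmodClosed.Build R (T -> R) bounded_pred bounded_pred_submod.

Record bounded_function : predArgType :=
  BoundedFunction { bfun_val :> T -> R ; _ : bfun_val \in bounded_pred }.

HB.instance Definition _ := [isSub for bfun_val].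
HB.instance Definition _ := [Choice of bounded_function by <:].
HB.instance Definition _ := [SubChoice_isSubLmodule of bounded_function by <:].

(** For empty [T] the supremum is taken over the empty set and is 0 by convention, whence the case
    splits below. *)
Definition sup_norm (f : bounded_function) : R := sup [set `|f t| | t in setT].

Lemma le_sup_norm (f : bounded_function) t : `|f t| <= sup_norm f.
Proof.
have /asboolP[M fM] := valP f.
by apply: ub_le_sup; [exists M => _ [s _ <-]; exact: fM|exists t].
Qed.

Lemma sup_norm_le (f : bounded_function) M :
  0 <= M -> (forall t, `|f t| <= M) -> sup_norm f <= M.
Proof.
move=> M0 fM; rewrite /sup_norm; set S := [set _ | _ in _].
have [->|/set0P S0] := eqVneq S set0; first by rewrite sup0.
by apply: ge_sup => // _ [t _ <-].
Qed.

Lemma sup_norm_ge0 (f : bounded_function) : 0 <= sup_norm f.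
Proof.
rewrite /sup_norm; set S := [set _ | _ in _].
have [->|/set0P[_ [t _ _]]] := eqVneq S set0; first by rewrite sup0.
exact: le_trans (le_sup_norm f t).
Qed.

Let sup_normD f g : sup_norm (f + g) <= sup_norm f + sup_norm g.
Proof.
apply: sup_norm_le => [|t]; first by rewrite addr_ge0// sup_norm_ge0.
by rewrite (le_trans (ler_normD _ _))// lerD// le_sup_norm.
Qed.

Let sup_normZ_le (a : R) f : sup_norm (a *: f) <= `|a| * sup_norm f.
Proof.
apply: sup_norm_le => [|t]; first by rewrite mulr_ge0// sup_norm_ge0.
by rewrite normrM ler_wpM2l// le_sup_norm.
Qed.

Let sup_normZ (a : R) f : sup_norm (a *: f) = `|a| * sup_norm f.
Proof.
apply/eqP; rewrite eq_le sup_normZ_le/=.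
have [->|a0] := eqVneq a 0; first by rewrite normr0 mul0r sup_norm_ge0.
rewrite -[X in _ * sup_norm X]scale1r -(mulVf a0) -scalerA mulrC.
rewrite -ler_pdivlMr ?normr_gt0// mulrC -normfV.
exact: sup_normZ_le.
Qed.

Let sup_norm0_eq0 f : sup_norm f = 0 -> f = 0.
Proof.
move=> f0; apply: val_inj; apply/funext => t; apply/eqP.
by rewrite -normr_le0 -f0 le_sup_norm.
Qed.

HB.instance Definition _ := Lmodule_isNormed.Build R bounded_function
  sup_normD sup_normZ sup_norm0_eq0.

Lemma bfun_le_norm (f : bounded_function) t : `|f t| <= `|f|.
Proof. exact: le_sup_norm. Qed.

Lemma bfun_norm_le (f : bounded_function) M :
  0 <= M -> (forall t, `|f t| <= M) -> `|f| <= M.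
Proof. exact: sup_norm_le. Qed.

Let bounded_function_complete (A : set_system bounded_function) :
  ProperFilter A -> cauchy A -> cvg A.
Proof.
move=> PA /cauchy_ballP cA.
have cA' e : 0 < e -> exists P Q, [/\ A P, A Q &
    forall f g, P f -> Q g -> forall t, `|f t - g t| < e].
  move=> e0; have [[P Q] /= [AP AQ] PQ] := cA e e0.
  exists P, Q; split => // f g Pf Qg t.
  have := PQ (f, g) (conj Pf Qg); rewrite -ball_normE /ball_ /=.
  exact/le_lt_trans/(bfun_le_norm (f - g)).
have /choice[g cvgg] : forall t, exists l : R,
    (fun f : bounded_function => f t) @ A --> l.
  move=> t; apply/cvg_ex; apply: cauchy_cvg; apply/cauchy_ballP => e e0.
  have [P [Q [AP AQ PQ]]] := cA' e e0.
  exists ((fun f => f t) @` P, (fun f => f t) @` Q) => /=.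
    split; [apply: (@filterS _ A _ P)|apply: (@filterS _ A _ Q)] => // x Px.
      by exists x.
    by exists x.
  by move=> [_ _] /= [[f Pf <-] [h Qh <-]]; exact: PQ.
(* The auxiliary [h] depends on [t], but the Cauchy bound does not, so pointwise convergence becomes
   uniform. *)
have near_g e : 0 < e ->
    A [set f : bounded_function | forall t, `|f t - g t| <= e].
  move=> e0; have [P [Q [AP AQ PQ]]] := cA' e e0.
  apply: filterS AP => f Pf t; apply/ler_addgt0Pr => d d0.
  have /cvgrPdist_lt/(_ _ d0) gd := cvgg t.
  have [h [Qh hd]] := filter_ex (filterI AQ gd).
  rewrite (le_trans (ler_distD (h t) _ _))// lerD// ltW//; first exact: PQ.
  by rewrite distrC.
have bg : g \in bounded_pred.
  have [f fg] := filter_ex (near_g 1 ltr01).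
  apply/asboolP; exists (`|f| + 1) => t.
  rewrite -[g t](subrK (f t)) addrC (le_trans (ler_normD _ _))//.
  by rewrite lerD ?bfun_le_norm// distrC.
apply/cvg_ex; exists (BoundedFunction bg : bounded_function).
apply/cvgrPdist_le => e e0; apply: filterS (near_g _ e0) => f fg.
by apply: bfun_norm_le => [|t]; [exact: ltW|rewrite -normrN opprB; exact: fg].
Qed.

HB.instance Definition _ :=
  Uniform_isComplete.Build bounded_function bounded_function_complete.

End BoundedFunctions.

(** A common point is chosen at each [t] separately; any one ball of the family keeps the resulting
    function bounded. *)
Lemma hyperconvex_bounded_function (R : realType) (T : Type) :
  hyperconvex (bounded_function R T).
Proof.
move=> B hB; have [->|/set0P[b0 Bb0]] := eqVneq B set0; first by exists 0.
have /choice[g hg] : forall t, exists y : R, forall b, B b -> `|b.1 t - y| <= b.2.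
  move=> t; have [_ _ [b Bb <-] [b' Bb' <-]|y hy] :=
      @hyperconvex_real R [set (b.1 t : R^o, b.2) | b in B].
    exact/le_trans/(hB _ _ Bb Bb')/(bfun_le_norm (b.1 - b'.1)).
  by exists y => b Bb; exact: (hy (_, _) (ex_intro2 _ _ b Bb erefl)).
have bg : g \in @bounded_pred R T.
  apply/asboolP; exists (`|b0.1| + b0.2) => t.
  rewrite -[g t](subrK (b0.1 t)) addrC (le_trans (ler_normD _ _))//.
  by rewrite lerD ?bfun_le_norm// distrC hg.
exists (BoundedFunction bg) => b Bb; apply: bfun_norm_le => [|t].
  by have := hB _ _ Bb Bb; rewrite subrr normr0; lra.
exact: hg.
Qed.

(** Send [x] to the function [z |-> phi z x], with [phi z] norming for [z]; the coordinate [z = x]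
    attains the norm of [x]. *)
Lemma isometric_embedding (R : realType) (V : completeNormedModType R) :
  exists (Z : completeNormedModType R) (i : {linear V -> Z}),
    hyperconvex Z /\ forall x, `|i x| = `|x|.
Proof.
have /choice[phi hphi] := @norming_functional R V.
have bphi x : (fun z => phi z x) \in @bounded_pred R V.
  by apply/asboolP; exists `|x| => z; exact: (hphi z).2.
pose f x : bounded_function R V := BoundedFunction (bphi x).
have lf : linear f.
  by move=> k x y; apply: val_inj; apply/funext => z; exact: linearP.
pose i : {linear V -> bounded_function R V} :=
  HB.pack f (GRing.isLinear.Build _ _ _ _ f lf).
exists (bounded_function R V), i; split.
  exact: hyperconvex_bounded_function.
move=> x; apply/eqP; rewrite eq_le; apply/andP; split.
  by apply: bfun_norm_le => // z; exact: (hphi z).2.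
by have := bfun_le_norm (f x) x; rewrite /= (hphi x).1 normr_id.
Qed.

(** * First widths, and a criterion for the gap in terms of balls *)

Section Line.
Variables (R : realType) (X : lmodType R) (s : X).

Definition line_pred : {pred X} := fun x => `[< exists c, x = c *: s >].

Let line_pred_submod : submod_closed line_pred.
Proof.
split; first by apply/asboolP; exists 0; rewrite scale0r.
move=> k x y /asboolP[c ->] /asboolP[d ->]; apply/asboolP.
by exists (k * c + d); rewrite scalerDl scalerA.
Qed.

HB.instance Definition _ :=
  GRing.isSubmodClosed.Build R X line_pred line_pred_submod.

Definition line : submodClosed X := line_pred.

Lemma lineP x : reflect (exists c, x = c *: s) (x \in line).
Proof. exact: asboolP. Qed.

Lemma dim_line : dim_at_most 1 line.
Proof.
have [s0|s0] := eqVneq s 0.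
  exists 0%N => //; exists (fun=> 0); split; first by move=> c _ [].
  move=> x; split => [/lineP[c ->]|[c ->]].
    by exists (fun=> 0); rewrite big_ord0 s0 scaler0.
  by rewrite big_ord0; apply/lineP; exists 0; rewrite scale0r.
exists 1%N => //; exists (fun=> s); split.
  move=> c; rewrite big_ord1 => /eqP; rewrite scaler_eq0 (negPf s0) orbF.
  by move=> /eqP c0 i; rewrite ord1.
move=> x; split => [/lineP[c ->]|[c ->]].
  by exists (fun=> c); rewrite big_ord1.
by rewrite big_ord1; apply/lineP; exists (c ord0).
Qed.

End Line.

Lemma dim_at_most1 (R : realType) (X : lmodType R) (V : submodClosed X) :
  dim_at_most 1 V -> exists s, forall x, x \in V -> exists c, x = c *: s.
Proof.
case=> -[|[|//]] _ [e [_ Ve]].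
  by exists 0 => x /Ve[c ->]; exists 0; rewrite big_ord0 scale0r.
by exists (e ord0) => x /Ve[c ->]; exists (c ord0); rewrite big_ord1.
Qed.

Section WidthOne.
Variables (R : realType) (X : normedModType R) (K : set X) (d : R).

Lemma kolmogorov_width1_le s :
  (forall x, K x -> exists c, `|x - c *: s| <= d) ->
  (kolmogorov_width 1 K <= d%:E)%E.
Proof.
move=> Ks; apply: (@le_trans _ _ (ereal_sup
  [set ereal_inf [set `|x - z|%:E | z in [set` line s]] | x in K])).
  by apply: ereal_inf_lbound; exists (line s) => //; exact: dim_line.
apply: ge_ereal_sup => _ [x Kx <-]; have [c xc] := Ks _ Kx.
apply: (@le_trans _ _ `|x - c *: s|%:E); last by rewrite lee_fin.
by apply: ereal_inf_lbound; exists (c *: s) => //=; apply/lineP; exists c.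
Qed.

Lemma kolmogorov_width1_lt :
  (kolmogorov_width 1 K < d%:E)%E ->
  exists s, forall x, K x -> exists c, `|x - c *: s| < d.
Proof.
move=> /ereal_inf_lt[_ [V /= /dim_at_most1[s Vs] <-] Vd].
exists s => x Kx.
have /ereal_inf_lt[_ [z /= Vz <-]] :
    (ereal_inf [set `|x - z|%:E | z in [set` V]] < d%:E)%E.
  by apply: le_lt_trans Vd; apply: ereal_sup_ubound; exists x.
by have [c ->] := Vs _ Vz; rewrite lte_fin; exists c.
Qed.

End WidthOne.

(* The points [(c + N q) / r] of [K], with [N] large, force an approximating line
   to have direction close to [q], and then the line through [v + N q] comes
   within distance 1 of them when [v] lies in all the balls [B(c, r)]. Such a
   [v] exists in a larger space, but not in [V], even modulo [q]. *)
Lemma width_gap (R : realType) (V : completeNormedModType R) (q : V)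
    (B : set (V * R)) (r0 m M eps : R) :
  q != 0 -> 0 < m -> 0 < eps -> B (0, r0) ->
  (forall b, B b -> [/\ m <= b.2, b.2 <= M & `|b.1| <= M]) ->
  (forall b b', B b -> B b' -> `|b.1 - b'.1| <= b.2 + b'.2) ->
  ~ (exists v, forall b, B b ->
       exists t, `|b.1 - v - t *: q| <= b.2 + eps) ->
  exists K : set V,
    [/\ bounded_set K, [set - u | u in K] = K &
        (absolute_width 1 K < kolmogorov_width 1 K)%E].
Proof.
move=> q0 m0 eps0 B0 BM Bpair Bempty.
have nq0 : 0 < `|q| by rewrite normr_gt0.
have Bpos b : B b -> 0 < b.2 by move=> /BM[/(lt_le_trans m0)].
have M0 : 0 < M.
  by have [_ r0M _] := BM _ B0; exact: lt_le_trans (Bpos _ B0) r0M.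
(* [W] will bound [|t0 *: s|] from below; the final error [|th| * |v|] is then at most
   [(5 M / W) * 2 M = eps / 2]. *)
pose W := 20%:R * M ^+ 2 / eps.
have W0 : 0 < W by rewrite divr_gt0// mulr_gt0// exprn_gt0.
pose N := (2%:R * M + W) / `|q|.
have NqE : `|N *: q| = 2%:R * M + W.
  rewrite normrZ ger0_norm; first by rewrite divfK// gt_eqF.
  by rewrite divr_ge0// ltW// addr_gt0// mulr_gt0.
pose w (b : V * R) : V := b.2^-1 *: (b.1 + N *: q).
pose K := [set x | exists b k, [/\ B b, `|k| = 1 & x = k *: w b]].
exists K; split.
- exists (m^-1 * (M + `|N *: q|)); split; first by rewrite num_real.
  move=> C /ltW mC _ [b [k [Bb k1 ->]]]; apply: le_trans mC.
  have [bm _ bM] := BM _ Bb; have b0 := Bpos _ Bb.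
  rewrite normrZ k1 mul1r normrZ ler_pM//.
    by rewrite gtr0_norm ?invr_gt0// lef_pV2// posrE.
  by rewrite (le_trans (ler_normD _ _))// lerD.
- have KN x : K x -> K (- x).
    by move=> [b [k [Bb k1 ->]]]; exists b, (- k); rewrite normrN scaleNr.
  apply/seteqP; split => [_ [x Kx <-]|x Kx]; first exact: KN.
  by exists (- x); rewrite ?opprK//; exact: KN.
(* Chosen so that [eta <= 1] and [M * eta <= eps / 2]: a radius stretched by [1 + eta] grows by at
   most [eps / 2] and stays below [2 M]. *)
pose eta := eps / (2%:R * M + eps).
have den0 : 0 < 2%:R * M + eps by rewrite addr_gt0// mulr_gt0.
have eta0 : 0 < eta by rewrite divr_gt0.
have eta1 : eta <= 1 by rewrite ler_pdivrMr// mul1r lerDr mulr_ge0// ltW.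
have etaM : M * eta <= eps / 2%:R.
  rewrite /eta mulrA ler_pdivrMr//.
  have := mulr_gt0 eps0 eps0; have := mulr_gt0 eps0 M0; lra.
apply: (@le_lt_trans _ _ 1%:E).
  (* Upper bound: in a hyperconvex [Z] the balls have a common point [y], and the line of
     [y + N *: i q] is within 1 of every point of [K]. *)
  have [Z [i [hZ iiso]]] := isometric_embedding V.
  apply: (@le_trans _ _ (kolmogorov_width 1 (i @` K))).
    by apply: ereal_inf_lbound; exists Z, i.
  have [_ _ [b Bb <-] [b' Bb' <-]|y hy] := hZ [set (i b.1, b.2) | b in B].
    by rewrite /= -linearB iiso; exact: Bpair.
  apply: (@kolmogorov_width1_le _ _ _ _ (y + N *: i q)).
  move=> _ [_ [b [k [Bb k1 ->]]] <-]; exists (k * b.2^-1).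
  have -> : i (k *: w b) - (k * b.2^-1) *: (y + N *: i q) =
            k *: (b.2^-1 *: (i b.1 - y)).
    rewrite -scalerA linearZ -scalerBr /w linearZ -scalerBr.
    congr (_ *: (_ *: _)).
    by rewrite linearD linearZ opprD addrACA subrr addr0.
  have b0 := Bpos _ Bb.
  rewrite normrZ k1 mul1r normrZ gtr0_norm ?invr_gt0//.
  rewrite mulrC ler_pdivrMr// mul1r.
  exact: (hy (i b.1, b.2) (ex_intro2 _ _ b Bb erefl)).
apply: (@lt_le_trans _ _ (1 + eta)%:E); first by rewrite lte_fin ltrDl.
(* Lower bound: a line with deviation below [1 + eta] would give a [v] excluded by [Bempty]. *)
rewrite leNgt; apply/negP => /kolmogorov_width1_lt[s Ks].
have {}Ks b : B b -> exists t, `|b.1 + N *: q - t *: s| <= b.2 * (1 + eta).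
  move=> Bb; have b0 := Bpos _ Bb.
  have [|c /ltW hc] := Ks (w b); first by exists b, 1; rewrite normr1 scale1r.
  exists (b.2 * c).
  have -> : b.1 + N *: q - (b.2 * c) *: s = b.2 *: (w b - c *: s).
    by rewrite scalerBr !scalerA mulfV ?gt_eqF// scale1r.
  by rewrite normrZ gtr0_norm// ler_wpM2l// ltW.
have Ble b : B b ->
    b.2 * (1 + eta) <= b.2 + eps / 2%:R /\ b.2 * (1 + eta) <= 2%:R * M.
  move=> Bb; have [_ bM _] := BM _ Bb; have b0 := Bpos _ Bb.
  have h1 : b.2 * eta <= M * eta by rewrite ler_wpM2r// ltW.
  have h2 : M * eta <= M * 1 by rewrite ler_wpM2l// ltW.
  by split; lra.
(* The ball centred at 0 places a point [t0 *: s] of the line near [N *: q]; their difference is the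
   candidate [v]. *)
have [t0 /=] := Ks _ B0; rewrite add0r => ht0.
have {}ht0 : `|N *: q - t0 *: s| <= 2%:R * M.
  by apply: le_trans ht0 _; exact: (Ble _ B0).2.
have t00 : t0 != 0.
  apply: contraTneq ht0 => ->; rewrite scale0r subr0 NqE -ltNge; lra.
pose v := t0 *: s - N *: q.
have nv : `|v| <= 2%:R * M by rewrite distrC.
have nts : W <= `|t0 *: s|.
  have := ler_distD (t0 *: s) (N *: q) 0; rewrite !subr0 NqE; lra.
apply: Bempty; exists v => b Bb.
have [t ht] := Ks _ Bb; have [h1 h2] := Ble _ Bb; have [_ _ bM] := BM _ Bb.
(* Since [t *: s = (1 + th) *: (v + N *: q)], passing from [t0 *: s] to [t *: s] costs a multiple of
   [q], which is allowed, and the small term [th *: v]. *)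
pose th := t / t0 - 1; exists (th * N).
have tE : t *: s = (t / t0) *: (t0 *: s) by rewrite scalerA divfK.
have thE : th *: (t0 *: s) = (b.1 - v) - (b.1 + N *: q - t *: s).
  rewrite /th scalerBl scale1r -tE -[X in _ - X = _](subrK (N *: q)) -/v.
  rewrite (opprB (b.1 + _)) [RHS]addrC !opprD -[RHS]addrA; congr (_ + _).
  by rewrite addrACA addNr add0r addrC.
have nth : `|th| * W <= 5%:R * M.
  rewrite (le_trans (ler_wpM2l (normr_ge0 th) nts))// -normrZ thE.
  rewrite (le_trans (ler_normB _ _))//.
  have := ler_normB b.1 v; lra.
have -> : b.1 - v - (th * N) *: q = (b.1 + N *: q - t *: s) + th *: v.
  have -> : th *: v = th *: (t0 *: s) - (th * N) *: q 
    by rewrite /v scalerBr (scalerA th N).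
  by rewrite thE addrA addrCA subrr addr0.
rewrite (le_trans (ler_normD _ _))// normrZ.
have : `|th| * `|v| <= eps / 2%:R.
  have : `|th| * `|v| <= `|th| * (2%:R * M) by rewrite ler_wpM2l.
  move=> /le_trans; apply.
  rewrite -(ler_pM2r W0) mulrAC (le_trans (ler_wpM2r _ nth))//.
    by rewrite mulr_ge0// ltW.
  have -> : eps / 2%:R * W = 10%:R * M ^+ 2.
    have : eps * W = 20%:R * M ^+ 2 by rewrite /W mulrC divfK// gt_eqF.
    lra.
  rewrite expr2; lra.
lra.
Qed.

(** * Two families of balls in the l1 sum of the real line and [X] *)

Lemma width_gap_orthogonal (R : realType) (X : completeNormedModType R)
    (a b q : X) :
  q != 0 -> `|a| = 1 -> `|b| = 1 -> `|a + b| < 2%:R -> `|a - b| < 2%:R ->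
  (forall t, 1 <= `|a - t *: q|) -> (forall t, 1 <= `|b - t *: q|) ->
  exists K : set (l1_sum R^o X),
    [/\ bounded_set K, [set - u | u in K] = K &
        (absolute_width 1 K < kolmogorov_width 1 K)%E].
Proof.
move=> q0 a1 b1 abD abB aq bq.
pose m := Num.max `|a + b| `|a - b|.
have mD : `|a + b| <= m by rewrite /m le_max lexx.
have mB : `|a - b| <= m by rewrite /m le_max lexx orbT.
have m2 : m < 2%:R by rewrite /m gt_max abD abB.
have m0 : 0 <= m := le_trans (normr_ge0 _) mD.
(* The largest shift for which [2 h + m <= 2], so that the unit balls at [A e] and [B e'] still
   meet. *)
pose h : R := 1 - m / 2%:R.
have h0 : 0 < h by rewrite /h; lra.
pose sgn (e : bool) : R := (-1) ^+ e.
have nsgn e : `|sgn e| = 1 by rewrite normrX normrN1 expr1n.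
have sab e e' : `|sgn e *: a - sgn e' *: b| <= m.
  rewrite /sgn; case: e e' => [] []; rewrite ?expr0 ?expr1 ?scaleN1r ?scale1r//.
  - by rewrite opprK addrC distrC.
  - by rewrite -opprD normrN.
  - by rewrite opprK.
have saa e e' (x : X) : `|x| = 1 -> `|sgn e *: x - sgn e' *: x| <= 2%:R.
  by move=> x1; rewrite (le_trans (ler_normB _ _))// !normrZ !nsgn x1; lra.
pose A e : l1_sum R^o X := (h : R^o, sgn e *: a).
pose B e : l1_sum R^o X := (- h : R^o, sgn e *: b).
(* The unit ball at 0 is added because [width_gap] requires a ball centred there. *)
pose F := [set p : l1_sum R^o X * R |
  [\/ p = (0, 1), exists e, p = (A e, 1) | exists e, p = (B e, 1)] ].
have nA e : `|A e| <= 2%:R.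
  by rewrite l1_normE /= normrZ nsgn a1 gtr0_norm// /h; lra.
have nB e : `|B e| <= 2%:R.
  by rewrite l1_normE /= normrZ nsgn b1 normrN gtr0_norm// /h; lra.
have AB e e' : `|A e - B e'| <= 2%:R.
  have hh : 0 < h + h by lra.
  rewrite l1_normE /= opprK gtr0_norm//.
  by have := sab e e'; rewrite /h; lra.
apply: (@width_gap _ _ ((0 : R^o, q) : l1_sum R^o X) F 1 1 2%:R (h / 2%:R)).
- by apply: contra_neq q0 => -[].
- by [].
- by rewrite divr_gt0.
- exact: Or31.
- by move=> _ [->|[e ->]|[e ->]] /=; rewrite ?normr0 ?nA ?nB; split; lra.
- have e2 : 1 + 1 = 2%:R :> R by lra.
  move=> _ _ [->|[e ->]|[e ->]] [->|[e' ->]|[e' ->]] /=;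
    rewrite ?e2 ?subr0 ?sub0r ?normrN ?normr0 ?ler0n//.
  + by rewrite l1_normE /= subrr normr0 add0r saa.
  + by rewrite distrC.
  + by rewrite l1_normE /= subrr normr0 add0r saa.
- move=> [[c z] hv].
  (* The [X]-parts of the distances to the centres with [x] and [-x] sum to at least 2 by
     orthogonality to [q]. The total is at most [2 + h], which leaves [h] for [2 |k - c|]. *)
  have key (k : R) (x : X) : (forall t, 1 <= `|x - t *: q|) ->
      (forall e, exists t, `|((k : R^o, sgn e *: x) : l1_sum R^o X) - (c, z) -
                    t *: ((0 : R^o, q) : l1_sum R^o X)| <= 1 + h / 2%:R) ->
      `|k - c| <= h / 2%:R.
    move=> xq hx; have [t] := hx false; have [u] := hx true.
    rewrite !l1_normE /= !scaler0 !subr0 /sgn expr0 expr1 scale1r scaleN1r.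
    move=> hu ht.
    have : 2%:R <= `|(x - z - t *: q) - (- x - z - u *: q)|.
      have -> : (x - z - t *: q) - (- x - z - u *: q) =
                2%:R *: (x - ((t - u) / 2%:R) *: q).
        rewrite scalerBr scalerA mulrC divfK ?pnatr_eq0// scaler_nat mulr2n.
        rewrite scalerBl !opprD !opprK addrACA; congr (_ + _).
        by rewrite addrACA addNr addr0.
      by rewrite normrZ normr_nat ler_peMr.
    have := ler_normB (x - z - t *: q) (- x - z - u *: q); lra.
  have hA : `|h - c| <= h / 2%:R.
    by apply: (key h a aq) => e; apply: (hv (A e, 1)); apply: Or32; exists e.
  have hB : `|- h - c| <= h / 2%:R.
    by apply: (key (- h) b bq) => e; apply: (hv (B e, 1)); apply: Or33; exists e.
  move: hA hB; rewrite !ler_norml; lra.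
Qed.

(** Modulo [(1, 0)] only the [X]-component of a point matters, so the balls of [X] can be placed at
    first coordinate 0. *)
Lemma width_gap_balls (R : realType) (X : completeNormedModType R)
    (F : set (X * R)) (D eps : R) :
  0 < eps -> (forall b, F b -> b.2 <= D) ->
  (forall b b', F b -> F b' -> `|b.1 - b'.1| <= b.2 + b'.2) ->
  ~ (exists x, forall b, F b -> `|b.1 - x| <= b.2 + eps) ->
  exists K : set (l1_sum R^o X),
    [/\ bounded_set K, [set - u | u in K] = K &
        (absolute_width 1 K < kolmogorov_width 1 K)%E].
Proof.
move=> eps0 FD Fpair Fempty.
have [F0|/set0P[b0 Fb0]] := eqVneq F set0.
  by exfalso; apply: Fempty; exists 0 => b; rewrite F0.
have F2 b : F b -> 0 <= b.2.
  by move=> Fb; have := Fpair _ _ Fb Fb; rewrite subrr normr0; lra.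
(* Translation puts one centre at 0. Half of [eps] keeps the radii away from 0, the other half
   remains as slack. *)
pose f (b : X * R) : l1_sum R^o X * R :=
  ((0 : R^o, b.1 - b0.1), b.2 + eps / 2%:R).
apply: (@width_gap _ _ ((1 : R^o, 0) : l1_sum R^o X) [set f b | b in F]
   (b0.2 + eps / 2%:R) (eps / 2%:R) (2%:R * D + eps) (eps / 2%:R)).
- by apply/eqP => -[/eqP]; rewrite oner_eq0.
- by rewrite divr_gt0.
- by rewrite divr_gt0.
- by exists b0 => //; rewrite /f subrr.
- move=> _ [b Fb <-]; rewrite /f l1_normE /= normr0 add0r.
  have := Fpair _ _ Fb Fb0; have := F2 _ Fb; have := FD _ Fb.
  by have := FD _ Fb0; split; lra.
- move=> _ _ [b Fb <-] [b' Fb' <-]; rewrite l1_normE /= subrr normr0 add0r.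
  rewrite opprB addrA subrK; have := Fpair _ _ Fb Fb'; lra.
- move=> [[c z] hv]; apply: Fempty; exists (b0.1 + z) => b Fb.
  have [t] := hv _ (ex_intro2 _ _ b Fb erefl).
  rewrite l1_normE /= scaler0 subr0 opprD addrA.
  have := normr_ge0 (0 - c - t *: (1 : R^o)); lra.
Qed.

(** * From approximate to exact common points *)

(** Take points [x n] common to the balls of radius at most [n] up to [1 / (n + 1)]. Their
    coordinates are eventually bounded, and a cluster point lies in every ball, as each ball is
    eventually considered. *)
Lemma hyperconvex_compactness (R : realType) (X : normedModType R)
    (a b : X) (C : R) (F : set (X * R)) :
  0 <= C ->
  (forall x, exists s t, [/\ x = s *: a + t *: b, `|s| <= C * `|x| &
                             `|t| <= C * `|x| ]) ->
  (forall D eps, 0 < eps ->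
     exists x, forall p, F p -> p.2 <= D -> `|p.1 - x| <= p.2 + eps) ->
  exists x, forall p, F p -> `|p.1 - x| <= p.2.
Proof.
move=> C0 coord Fapprox.
have [->|/set0P[p0 Fp0]] := eqVneq F set0; first by exists 0.
have /choice[x hx] (n : nat) : exists x, forall p, F p -> p.2 <= n%:R ->
    `|p.1 - x| <= p.2 + n.+1%:R^-1.
  by apply: Fapprox; rewrite invr_gt0 ltr0n.
have /choice[st hst] (n : nat) : exists st : R^o * R^o,
    [/\ x n = st.1 *: a + st.2 *: b, `|st.1| <= C * `|x n| &
        `|st.2| <= C * `|x n| ].
  by have [s [t h]] := coord (x n); exists (s, t).
pose L := C * (`|p0.1| + p0.2 + 1).
pose S : set (R^o * R^o) := `[- L, L]%classic `*` `[- L, L]%classic.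
have cS : compact S by apply: compact_setX; exact: segment_compact.
have [|[s t] [_ clst]] := cS (st @ \oo) _.
  change (\forall n \near \oo, S (st n)).
  apply: filterS (@nbhs_infty_ger R p0.2) => n p0n.
  have xn : `|x n| <= `|p0.1| + p0.2 + 1.
    have n1 : n.+1%:R^-1 <= 1 :> R by rewrite invf_le1 ?ltr0n// ler1n.
    rewrite -[x n](subKr p0.1) (le_trans (ler_normB _ _))// -addrA lerD2l.
    by rewrite (le_trans (hx n p0 Fp0 p0n))// lerD2l.
  have [_ s1 t1] := hst n; have CL := ler_wpM2l C0 xn.
  by split; rewrite /= in_itv/= -ler_norml;
    [exact: le_trans s1 CL|exact: le_trans t1 CL].
exists (s *: a + t *: b) => p Fp; apply/ler_addgt0Pr => e e0.
(* Moving both coordinates by less than [d] moves the point by at most [e / 2]; the other [e / 2]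
   absorbs the slack of [x n]. *)
pose d := e / 2%:R / (`|a| + `|b| + 1).
have ab0 : 0 < `|a| + `|b| + 1 by rewrite ltr_wpDl// addr_ge0.
have d0 : 0 < d by rewrite divr_gt0// divr_gt0.
have e20 : 0 < e / 2%:R by rewrite divr_gt0.
have near_n : (st @ \oo) [set st n | n in
    [set n : nat | p.2 <= n%:R /\ n.+1%:R^-1 < e / 2%:R]].
  apply: filterS2 (@nbhs_infty_ger R p.2)
    (near_infty_natSinv_lt (PosNum e20)) => n pn en.
  by exists n.
have near_st : nbhs (s, t)
    [set u : R^o * R^o | `|s - u.1| < d /\ `|t - u.2| < d].
  exists (ball s d, ball t d); first by split; exact: nbhsx_ballx.
  by move=> u [].
have [_ [[n [pn en] <-] [/= sn tn]]] := clst _ _ near_n near_st.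
have [xE _ _] := hst n.
have -> : p.1 - (s *: a + t *: b) =
    (p.1 - x n) - ((s - (st n).1) *: a + (t - (st n).2) *: b).
  by rewrite xE !scalerBl addrACA -opprD opprB addrA subrK.
rewrite (le_trans (ler_normB _ _))//.
have h1 := hx n p Fp pn.
have h2 := ler_normD ((s - (st n).1) *: a) ((t - (st n).2) *: b).
have h3 : `|(s - (st n).1) *: a| <= d * `|a|.
  by rewrite normrZ ler_wpM2r// ltW.
have h4 : `|(t - (st n).2) *: b| <= d * `|b|.
  by rewrite normrZ ler_wpM2r// ltW.
have h5 : d * (`|a| + `|b| + 1) = e / 2%:R by rewrite divfK// gt_eqF.
have h6 := le_trans h2 (lerD h3 h4).
rewrite (le_trans (lerD h1 h6))// -addrA lerD2l [leRHS]splitr lerD ?(ltW en)//.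
by rewrite -h5 !mulrDr mulr1 lerDl ltW.
Qed.

(** * Unit vectors, norming functionals and coordinates *)

Definition independent2 (R : realType) (X : lmodType R) (a b : X) : Prop :=
  forall k l : R, k *: a + l *: b = 0 -> k = 0 /\ l = 0.

(* If [|a + b| = 2] then the segment [[a, b]] lies on the unit sphere, and its
   midpoint and direction can be used instead of [a] and [b]. *)
Lemma unit_midpoint (R : realType) (X : normedModType R) (a b : X) :
  independent2 a b -> `|a| = 1 -> `|b| = 1 -> 2%:R <= `|a + b| ->
  exists a' b' : X, [/\ independent2 a' b', `|a'| = 1, `|b'| = 1,
    `|a' + b'| < 2%:R & `|a' - b'| < 2%:R].
Proof.
move=> iab a1 b1 ab2.
have ab : `|a + b| = 2%:R.
  by apply/eqP; rewrite eq_le ab2 andbT (le_trans (ler_normD _ _))// a1 b1; lra.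
pose d := a - b.
have d0 : d != 0.
  apply/eqP => d0; have [] := iab 1 (-1); last by move/eqP; rewrite oner_eq0.
  by rewrite scale1r scaleN1r.
have nd : 0 < `|d| by rewrite normr_gt0.
have nd2 : `|d| <= 2%:R by rewrite (le_trans (ler_normB _ _))// a1 b1; lra.
have half (x y : X) : 2%:R^-1 *: (x + y) + 2%:R^-1 *: (x - y) = x.
  rewrite -scalerDr addrACA subrr addr0 (_ : x + x = 2%:R *: x).
    by rewrite scalerA mulVf// scale1r.
  by rewrite scaler_nat mulr2n.
(* The new sum and difference are an endpoint [a] or [b] plus or minus [(1/|d| - 1/2) *: d], of norm
   at most [1 + (1 - |d|/2) < 2]. *)
have key (s : R) (x : X) : `|s| = 1 -> `|x| = 1 ->
    2%:R^-1 *: (a + b) + s *: (2%:R^-1 *: d) = x ->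
    `|2%:R^-1 *: (a + b) + s *: (`|d|^-1 *: d)| < 2%:R.
  move=> s1 x1 xE.
  have -> : 2%:R^-1 *: (a + b) + s *: (`|d|^-1 *: d) =
            x + s *: ((`|d|^-1 - 2%:R^-1) *: d).
    by rewrite -xE -addrA -scalerDr -scalerDl [2%:R^-1 + _]addrC subrK.
  rewrite (le_lt_trans (ler_normD _ _))// !normrZ s1 mul1r x1.
  rewrite ger0_norm ?subr_ge0 ?lef_pV2 ?posrE//.
  by rewrite mulrBl mulVf ?gt_eqF//; lra.
exists (2%:R^-1 *: (a + b)), (`|d|^-1 *: d); split.
- move=> k l.
  have -> : k *: (2^-1 *: (a + b)) + l *: (`|d|^-1 *: d) =
     (k / 2%:R + l / `|d|) *: a + (k / 2%:R - l / `|d|) *: b.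
    by rewrite !scalerA !scalerDr scalerDl scalerBl scalerN addrACA.
  move=> /iab[h1 h2].
  have k0 : k = 0 by lra.
  split => //; apply/eqP; move: h1; rewrite k0 mul0r add0r => /eqP.
  by rewrite mulf_eq0 invr_eq0 (gt_eqF nd) orbF.
- by rewrite normrZ ab ger0_norm// mulVf.
- by rewrite normrZ ger0_norm ?invr_ge0// mulVf// gt_eqF.
- rewrite -[X in _ + X]scale1r; apply: (key _ a); rewrite ?normr1// scale1r.
  exact: half.
- rewrite -[X in _ - X]scale1r -scaleNr; apply: (key _ b).
  + by rewrite normrN1.
  + by [].
  + by rewrite scaleN1r -scalerN opprB addrC [a + b]addrC addrC half.
Qed.

(** Normalise both vectors. If their sum or difference has norm 2, [unit_midpoint] applies to the
    second vector or to its opposite. *)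
Lemma independent_unit_vectors (R : realType) (X : normedModType R) (a b : X) :
  a != 0 -> (forall c, b != c *: a) ->
  exists a' b' : X, [/\ independent2 a' b', `|a'| = 1, `|b'| = 1,
    `|a' + b'| < 2%:R & `|a' - b'| < 2%:R].
Proof.
move=> a0 ba.
have b0 : b != 0 by have := ba 0; rewrite scale0r.
have na : 0 < `|a| by rewrite normr_gt0.
have nb : 0 < `|b| by rewrite normr_gt0.
have unit (x : X) : 0 < `|x| -> `|(`|x|^-1 *: x)| = 1.
  by move=> x0; rewrite normrZ ger0_norm ?invr_ge0// mulVf// gt_eqF.
have iab : independent2 (`|a|^-1 *: a) (`|b|^-1 *: b).
  move=> k l; rewrite !scalerA => h.
  have l0 : l / `|b| = 0.
    apply/eqP; apply: contraT => lb.
    have := ba (- (l / `|b|)^-1 * (k / `|a|)); rewrite -scalerA.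
    rewrite -[k / _ *: a]addr0 -(subrr (l / `|b| *: b)) addrA h sub0r.
    by rewrite scalerN scaleNr opprK scalerA mulVf// scale1r eqxx.
  move: h; rewrite l0 scale0r addr0 => /eqP; rewrite scaler_eq0 (negPf a0) orbF.
  rewrite mulf_eq0 invr_eq0 (gt_eqF na) orbF => /eqP ->; split => //.
  by move/eqP: l0; rewrite mulf_eq0 invr_eq0 (gt_eqF nb) orbF => /eqP.
have [abD|/unit_midpoint] := ltP `|(`|a|^-1 *: a) + `|b|^-1 *: b| 2%:R; last first.
  by apply => //; exact: unit.
have [abB|] := ltP `|(`|a|^-1 *: a) - `|b|^-1 *: b| 2%:R.
  by exists (`|a|^-1 *: a), (`|b|^-1 *: b); split => //; exact: unit.
move=> /unit_midpoint; apply; rewrite ?normrN; [|exact: unit..].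
move=> k l; rewrite scalerN -scaleNr => /iab[-> /eqP].
by rewrite oppr_eq0 => /eqP.
Qed.

Lemma kernel_orthogonal (R : realType) (X : normedModType R) (a q : X)
    (phi : {linear X -> R^o}) :
  phi a = 1 -> (forall y, `|phi y| <= `|y|) -> phi q = 0 ->
  forall t, 1 <= `|a - t *: q|.
Proof.
move=> pa pM pq t; apply: le_trans (pM _).
by rewrite linearB linearZ pa pq /= scaler0 subr0 normr1.
Qed.

(** The hypothesis excludes a nonzero [q] in the kernels of norming functionals of both [a] and [b].
    These two functionals therefore separate points, and [X] has dimension at most 2. *)
Lemma two_coordinates (R : realType) (X : normedModType R) :
  (forall a b q : X, q != 0 -> `|a| = 1 -> `|b| = 1 ->
     `|a + b| < 2%:R -> `|a - b| < 2%:R ->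
     (forall t, 1 <= `|a - t *: q|) -> ~ (forall t, 1 <= `|b - t *: q|)) ->
  exists (a b : X) (C : R), 0 <= C /\
    forall x, exists s t, [/\ x = s *: a + t *: b, `|s| <= C * `|x| &
                              `|t| <= C * `|x| ].
Proof.
move=> noq.
have [[a0 a00]|X0] := pselect (exists a : X, a != 0); last first.
  exists 0, 0, 0; split => // x; exists 0, 0.
  rewrite !scaler0 addr0 normr0 mul0r; split => //.
  by apply: contrapT => /eqP x0; apply: X0; exists x.
have [[b0 b0a0]|X1] := pselect (exists b, forall c, b != c *: a0); last first.
  exists a0, 0, `|a0|^-1; split; first by rewrite invr_ge0.
  move=> x; have [c xE] : exists c, x = c *: a0.
    apply: contrapT => nx; apply: X1; exists x => c.
    by apply/eqP => xE; apply: nx; exists c.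
  exists c, 0; rewrite scaler0 addr0 normr0 mulr_ge0 ?invr_ge0//; split => //.
  by rewrite xE normrZ mulrCA mulVf ?mulr1// normr_eq0.
have [a [b [iab a1 b1 abD abB]]] := independent_unit_vectors a00 b0a0.
have [phi [phia phiM]] := norming_functional a; rewrite a1 in phia.
have [psi [psib psiM]] := norming_functional b; rewrite b1 in psib.
have joint q : phi q = 0 -> psi q = 0 -> q = 0.
  move=> phiq psiq; apply/eqP; apply: contraT => q0; exfalso.
  by apply: (noq a b q) => //; [exact: (kernel_orthogonal phia phiM)|
    exact: (kernel_orthogonal psib psiM)].
pose al : R := phi b; pose be : R := psi a.
have al1 : `|al| <= 1 by rewrite -b1; exact: phiM.
have be1 : `|be| <= 1 by rewrite -a1; exact: psiM.
(* The determinant of [phi], [psi] on [a], [b]; if it vanished, [a - be *: b] would lie in both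
   kernels. *)
pose d := 1 - al * be.
have d0 : d != 0.
  apply/eqP => d0; have h : 1 = be * al by rewrite /d in d0; lra.
  have : a - be *: b = 0.
    apply: joint; rewrite linearB linearZ /=.
      by rewrite phia -/al -[be *: _]/(be * al) -h subrr.
    by rewrite psib -/be -[be *: _]/(be * 1) mulr1 subrr.
  rewrite -scaleNr -[a in a + _]scale1r => /iab[/eqP].
  by rewrite oner_eq0.
have nd : 0 < `|d| by rewrite normr_gt0.
exists a, b, (2%:R / `|d|); split; first by rewrite divr_ge0.
move=> x; pose p : R := phi x; pose q : R := psi x.
have px : `|p| <= `|x| by exact: phiM.
have qx : `|q| <= `|x| by exact: psiM.
(* Cramer's rule; [|al|, |be| <= 1] gives the constant [2 / |d|]. *)
pose s := (p - al * q) / d; pose t := (q - be * p) / d.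
have sd : s * d = p - al * q by rewrite divfK.
have td : t * d = q - be * p by rewrite divfK.
have bound (u v w : R) : `|u| <= `|x| -> `|v| <= `|x| -> `|w| <= 1 ->
    `|(u - w * v) / d| <= 2%:R / `|d| * `|x|.
  move=> ux vx w1; rewrite normrM normfV mulrAC ler_pM2r ?invr_gt0//.
  rewrite (le_trans (ler_normB _ _))// normrM.
  have := ler_pM (normr_ge0 w) (normr_ge0 v) w1 vx; lra.
exists s, t; split; [|exact: bound|exact: bound].
apply/eqP; rewrite -subr_eq0; apply/eqP; apply: joint.
  rewrite linearB linearD !linearZ /= phia -/p -/al.
  rewrite -[s *: _]/(s * 1) -[t *: _]/(t * al).
  apply: (mulIf d0); rewrite mul0r; have := congr1 ( *%R al) td.
  by move: sd; rewrite /d; clearbody s t al be p q; lra.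
rewrite linearB linearD !linearZ /= psib -/q -/be.
rewrite -[s *: _]/(s * be) -[t *: _]/(t * 1).
apply: (mulIf d0); rewrite mul0r; have := congr1 ( *%R be) sd.
by move: td; rewrite /d; clearbody s t al be p q; lra.
Qed.

(** * Contraposition: without a gap, [X] is hyperconvex *)

Theorem proposition3p4 (R : realType) (X : completeNormedModType R)
    (hX : ~ one_injective X) :
  exists K : set (l1_sum R^o X),
    [/\ bounded_set K,
        [set - u | u in K] = K &
        (absolute_width 1 K < kolmogorov_width 1 K)%E].
Proof.
apply: contrapT => noK; apply: hX; apply: hyperconvex_one_injective => F Fpair.
have [a [b [C [C0 coord]]]] : exists (a b : X) (C : R), 0 <= C /\
    forall x, exists s t, [/\ x = s *: a + t *: b, `|s| <= C * `|x| &
                              `|t| <= C * `|x| ].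
  apply: two_coordinates => a b q q0 a1 b1 abD abB aq bq; apply: noK.
  exact: (@width_gap_orthogonal _ _ a b q).
(* Only balls of radius at most [D] remain, as the bounded family in [width_gap_balls] requires;
   were they to have no common point up to [eps], they would yield a set [K]. *)
apply: (hyperconvex_compactness C0 coord) => D eps eps0.
apply: contrapT => nx; apply: noK.
apply: (@width_gap_balls _ _ [set p | F p /\ p.2 <= D] D eps) => //.
- by move=> p [].
- by move=> p p' [Fp _] [Fp' _]; exact: Fpair.
- by move=> [x hx]; apply: nx; exists x => p Fp pD; exact: hx.
Qed.
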